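(* Let $A$ be a (real or complex) Banach algebra and let $a\in A$. The following statements are equivalent: (1) $a$ is isolated in $L(A)$ (that is, $a$ is an isolated point of $L(A)$). (2) $a \in I(A)\cap Z(A)$, and any $b \in L(A)$ with $b^3 = a$ is such that $b = a$.
   Context: Algebras are real or complex associative algebras, not assumed unital. $L(A) := \{ a \in A : axay = axy \ \text{for all } x,y \in A\}$ is the set of endomorphic left elements of $A$, with the relative norm topology. $I(A)$ is the set of all idempotents of $A$, and $Z(A)$ is the centre of $A$. *)

(* Defs.v *)
From HB Require Import structures.
From mathcomp Require Import all_boot all_order all_algebra.
From mathcomp Require Import complex.
From mathcomp Require Import all_classical all_reals all_analysis.

Set Implicit Arguments.
Unset Strict Implicit.
Unset Printing Implicit Defensive.

Import Order.TTheory GRing.Theory Num.Theory.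
Import numFieldNormedType.Exports.

Local Open Scope classical_set_scope.
Local Open Scope ring_scope.

(* MathComp rings are unital, so a Banach algebra, which need not have a unit
   here, carries its own product on top of a Banach space over K. When
   K = R[i], the norm takes its values in the nonnegative reals of R[i]. *)
HB.mixin Record CompleteNormedModule_isBanachAlgebra (K : numFieldType) A
    of CompleteNormedModule K A := {
  bamul : A -> A -> A ;
  bamulA : associative bamul ;
  bamulDl : left_distributive bamul +%R ;
  bamulDr : right_distributive bamul +%R ;
  bamulZl : forall (k : K) (x y : A), bamul (k *: x) y = k *: bamul x y ;
  bamulZr : forall (k : K) (x y : A), bamul x (k *: y) = k *: bamul x y ;
  bamul_norm : forall x y : A, `|bamul x y| <= `|x| * `|y|
}.

#[short(type="banachAlgType")]
HB.structure Definition BanachAlgebra (K : numFieldType) :=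
  {A of CompleteNormedModule K A & CompleteNormedModule_isBanachAlgebra K A}.

Declare Scope banach_scope.
Delimit Scope banach_scope with BA.
Notation "x ** y" := (bamul x y)
  (at level 40, left associativity) : banach_scope.
Local Open Scope banach_scope.

Section BanachAlgebraSets.
Context {K : numFieldType} (A : banachAlgType K).

Definition endo_left : set A :=
  [set a | forall x y : A, a ** x ** a ** y = a ** x ** y].

Definition idempotents : set A := [set a | a ** a = a].

Definition centre : set A := [set a | forall x : A, a ** x = x ** a].

End BanachAlgebraSets.

Arguments endo_left {K} A _.
Arguments idempotents {K} A _.
Arguments centre {K} A _.

(* Main.v *)
Require Import Defs.
From mathcomp Require Import all_boot all_order all_algebra.
From mathcomp Require Import complex.
From mathcomp Require Import all_classical all_reals all_analysis.

(** The argument is uniform in the scalar field: it works over an arbitrary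
[numFieldType], of which [R] and [R[i]] are instances.

Let [a] be isolated in [L(A)]. An isolated point of [L(A)] lies on no line
contained in [L(A)] ([isolated_line_eq0]), and a line [a + t c] is contained in
[L(A)] as soon as the quadratic identity defining [L(A)] degenerates along it
([endo_left_line]). Four directions [c] satisfy this: [aa - a], whence [a] is
idempotent; then [xa - axa] and [ax - axa], whence [a] commutes with every [x];
finally, if [b] is in [L(A)] and [b^3 = a], the direction [b - a]. Indeed [b]
splits as the orthogonal sum of the central idempotent [a] and of the element
[n = b - a] of [L(A)], for which [n^3 = b^3 - a = 0], and an element of [L(A)]
whose cube is zero annihilates every product ([endo_left_nilp]).

Conversely, let [a] be a central idempotent and [b] an element of [L(A)] close
to [a]. Every element [b] of [L(A)] satisfies [b^3 y = b^2 y], so that its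
spectrum is contained in [{0, 1}]; the part [ab] of [b] is close to the unit [a]
of [aA], hence equal to it, while the part [b - a] is small, hence has cube
zero. Thus [b^3 = a], and uniqueness of the cube root [a] in [L(A)] yields
[b = a]. The only analytic ingredient is that [d w = w] with [|d| < 1] forces
[w = 0] ([bamul_fix_eq0]). *)

Set Implicit Arguments.
Unset Strict Implicit.
Unset Printing Implicit Defensive.

Import Order.TTheory GRing.Theory Num.Theory.
Import numFieldNormedType.Exports.

Local Open Scope classical_set_scope.
Local Open Scope ring_scope.
Local Open Scope complex_scope.
Local Open Scope banach_scope.

Section EndoLeft.
Context {K : numFieldType} {A : banachAlgType K}.
Implicit Types a b c d e n p q w x y : A.

Lemma bamul0l x : 0 ** x = 0.
Proof. by apply: (addrI (0 ** x)); rewrite -bamulDl !addr0. Qed.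

Lemma bamul0r x : x ** 0 = 0.
Proof. by apply: (addrI (x ** 0)); rewrite -bamulDr !addr0. Qed.

Lemma bamulBl x y w : (x - y) ** w = x ** w - y ** w.
Proof. by apply/eqP; rewrite eq_sym subr_eq -bamulDl subrK. Qed.

Lemma bamulBr w x y : w ** (x - y) = w ** x - w ** y.
Proof. by apply/eqP; rewrite eq_sym subr_eq -bamulDr subrK. Qed.

Lemma bamul_fix_eq0 d w : `|d| < 1 -> d ** w = w -> w = 0.
Proof.
move=> d1 dw; apply/eqP; rewrite -normr_eq0; apply/negPn/negP => w0.
have {w0} wp : 0 < `|w| by rewrite lt_def w0 normr_ge0.
have := bamul_norm d w; rewrite dw -{1}[`|w|]mul1r ler_pM2r //.
by move=> /(lt_le_trans d1); rewrite ltxx.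
Qed.

(** The points [a + t c] with [t] small and nonzero are points of [S] close to
[a], hence equal to [a]. *)
Lemma isolated_line_eq0 (S : set A) a c :
  isolated S a -> (forall t : K, S (a + t *: c)) -> c = 0.
Proof.
move=> [_ [V /nbhs_normP[e /= e0 eV] VS]] line.
have c1 : 0 < 1 + `|c| by rewrite ltr_pwDl.
(* this t gives |t c| < e, also when c = 0 *)
pose t := e / (1 + `|c|).
have t0 : 0 < t by rewrite divr_gt0.
have : (V `&` S) (a + t *: c).
  split; last exact: line.
  apply: eV; rewrite /ball_ /= opprD addrA subrr sub0r normrN normrZ.
  by rewrite gtr0_norm // /t mulrAC ltr_pdivrMr // ltr_pM2l // ltrDr.
rewrite VS /= -{2}[a]addr0 => /addrI/eqP.
by rewrite scaler_eq0 gt_eqF //= => /eqP.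
Qed.

(** Expanding [(a + t c) p (a + t c) q] in powers of [t], membership in [L(A)]
only needs [apcq + cpaq = cpq] and [cpcq = 0]; in every direction used below the
first of these splits as stated here. *)
Lemma endo_left_line a c (t : K) : endo_left A a ->
    (forall p q, a ** p ** c ** q = 0) ->
    (forall p q, c ** p ** a ** q = c ** p ** q) ->
    (forall p q, c ** p ** c ** q = 0) ->
  endo_left A (a + t *: c).
Proof.
move=> La ac ca cc p q.
rewrite !(bamulDl, bamulDr, bamulZl, bamulZr) La ac ca cc.
by rewrite !scaler0 !addr0.
Qed.

(** The function [u] stands for left multiplication by an element of the
unitization of [A], so that [c = u a]; the identities of [endo_left_line] that
begin with [c] are then left multiples of identities that begin with [a]. *)
Lemma endo_left_line_mul a c (u : A -> A) (t : K) : endo_left A a ->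
    u 0 = 0 -> (forall z, c ** z = u (a ** z)) ->
    (forall p q, a ** p ** c ** q = 0) ->
  endo_left A (a + t *: c).
Proof.
move=> La u0 cu ac; apply: endo_left_line => // p q; rewrite -!bamulA.
  by rewrite !cu !bamulA La.
by rewrite (cu (p ** _)) !bamulA ac.
Qed.

Lemma isolated_idempotent a : isolated (endo_left A) a -> a ** a = a.
Proof.
move=> iso; have La := isolatedS iso.
apply: subr0_eq; apply: (isolated_line_eq0 iso) => t.
apply: (@endo_left_line_mul _ _ (fun z => a ** z - z)) => // [|z|p q].
- by rewrite bamul0r subrr.
- by rewrite bamulBl bamulA.
- by rewrite bamulBr bamulBl !bamulA !La subrr.
Qed.

(** The two directions are the off-diagonal Peirce components [(1 - a) x a] and
[a x (1 - a)]: as [c^2 = 0], the lines [a + t c] consist of the conjugates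
of [a] by [1 + t c], respectively [1 - t c]. *)
Lemma isolated_centre a : isolated (endo_left A) a -> centre A a.
Proof.
move=> iso x; have La := isolatedS iso.
have xa : x ** a - a ** x ** a = 0.
  apply: (isolated_line_eq0 iso) => t.
  pose u z := x ** z - a ** x ** z.
  apply: (@endo_left_line_mul _ _ u) => // [|z|p q]; rewrite /u.
  - by rewrite !bamul0r subrr.
  - by rewrite bamulBl -!bamulA.
  - rewrite bamulBr bamulBl !bamulA La.
    by rewrite -(bamulA a p x) La subrr.
have ax : a ** x - a ** x ** a = 0.
  have c0 q : (a ** x - a ** x ** a) ** q = 0 by rewrite bamulBl La subrr.
  apply: (isolated_line_eq0 iso) => t.
  apply: endo_left_line => // p q; rewrite ?c0 ?bamul0l //.
  by rewrite -bamulA c0 bamul0r.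
by move/subr0_eq: xa => ->; move/subr0_eq: ax.
Qed.

Lemma endo_left_nilp n : endo_left A n -> n ** n ** n = 0 ->
  forall x y, n ** x ** y = 0.
Proof.
move=> Ln n3 x y.
have n2 z : n ** n ** z = 0 by rewrite -Ln n3 bamul0l.
(* replacing x by x n in n x n y = n x y makes n n appear on the left of y *)
rewrite -Ln; have := Ln (x ** n) y; rewrite !bamulA => <-.
by rewrite -(bamulA (n ** x)) -bamulA n2 bamul0r.
Qed.

Section Splitting.
Context {e : A}.
Hypotheses (ee : e ** e = e) (Ze : centre A e).

Lemma central_idempotent_endo_left : endo_left A e.
Proof. by move=> x y; rewrite -(bamulA e x e) -Ze !bamulA ee. Qed.

Lemma endo_left_subr b : endo_left A b -> e ** b = e -> endo_left A (b - e).
Proof.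
move=> Lb eb x y.
have be : b ** e = e by rewrite -Ze.
rewrite !(bamulBl, bamulBr) Lb central_idempotent_endo_left.
rewrite -(bamulA b x e) -(Ze x) bamulA be.
by rewrite subrr subr0 (Ze x) -(bamulA x) eb.
Qed.

(** The sum [b = e + (b - e)] is orthogonal, so [b^3 = e^3 + (b - e)^3]. *)
Lemma cube_sub_idempotent b : e ** b = e ->
  (b - e) ** (b - e) ** (b - e) = b ** b ** b - e.
Proof.
move=> eb; have be : b ** e = e by rewrite -Ze.
rewrite !(bamulBl, bamulBr) -(bamulA b b e) be !eb !ee eb be.
by rewrite !subrr !subr0.
Qed.

Lemma isolated_cube_unique b : isolated (endo_left A) e ->
  endo_left A b -> b ** b ** b = e -> b = e.
Proof.
move=> iso Lb b3; have Le := isolatedS iso.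
have eb : e ** b = e by rewrite -{1}b3 Lb.
have n0 x y : (b - e) ** x ** y = 0.
  apply: endo_left_nilp; first exact: endo_left_subr.
  by rewrite cube_sub_idempotent // b3 subrr.
have en : e ** (b - e) = 0 by rewrite bamulBr eb ee subrr.
apply: subr0_eq; apply: (isolated_line_eq0 iso) => t.
apply: endo_left_line => // p q; rewrite ?n0 ?bamul0l //.
by rewrite Ze -(bamulA p) en bamul0r bamul0l.
Qed.

(** With [f = eb] and [d = e - f], the relation [f^2 d = 0] is solved in two
steps: [f d] is fixed by [d], hence zero, and then so is [d]. *)
Lemma endo_left_near_unit b : endo_left A b -> `|e - e ** b| < 1 -> e ** b = e.
Proof.
move=> Lb; set d := e - e ** b => d1.
have ed : e ** d = d by rewrite bamulBr bamulA ee.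
have dfix z : e ** z = z -> e ** b ** z = 0 -> z = 0.
  move=> ez fz; apply: (bamul_fix_eq0 d1).
  by rewrite bamulBl ez fz subr0.
have : d = 0; last by move/subr0_eq => <-.
apply: (dfix) => //; apply: dfix; first by rewrite !bamulA ee.
have bbd : b ** b ** d = 0 by rewrite bamulBr Ze !bamulA Lb subrr.
by rewrite !bamulA -(bamulA e b e) -Ze bamulA ee -!(bamulA e) bbd bamul0r.
Qed.

(** As [n = b - e] satisfies [n^3 = n^2], its square is fixed by [n]. *)
Lemma endo_left_near_cube b : endo_left A b ->
  `|e - e ** b| < 1 -> `|b - e| < 1 -> b ** b ** b = e.
Proof.
move=> Lb d1 n1.
have eb := endo_left_near_unit Lb d1.
have Ln := endo_left_subr Lb eb.
apply: subr0_eq; rewrite -cube_sub_idempotent // -bamulA.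
set n := b - e in n1 Ln *.
by apply: (bamul_fix_eq0 n1); rewrite !bamulA Ln.
Qed.

Lemma cube_unique_isolated :
  (forall b, endo_left A b -> b ** b ** b = e -> b = e) ->
  isolated (endo_left A) e.
Proof.
move=> uniq; have Le := central_idempotent_endo_left.
split; first exact/mem_set.
have e1 : 0 < 1 + `|e| by rewrite ltr_pwDl.
(* with this radius both |e - b| and |e - e b| <= |e| |e - b| are below 1 *)
exists [set b | `|e - b| < (1 + `|e|)^-1].
  by apply/nbhs_normP; exists (1 + `|e|)^-1; rewrite /= ?invr_gt0.
apply/seteqP; split=> [b [/= eb Lb]|_ ->]; last first.
  by split=> //=; rewrite subrr normr0 invr_gt0.
have {}eb : (1 + `|e|) * `|e - b| < 1.
  by rewrite mulrC -ltr_pdivlMr // div1r.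
apply: uniq => //; apply: endo_left_near_cube => //.
  rewrite -{1}ee -bamulBr; apply: (le_lt_trans (bamul_norm _ _)).
  by apply: le_lt_trans eb; rewrite ler_wpM2r // lerDr.
by rewrite distrC; apply: le_lt_trans eb; rewrite ler_peMl // lerDl.
Qed.

End Splitting.

Lemma isolated_endo_leftP a :
  isolated (endo_left A) a <->
  (idempotents A `&` centre A) a /\
  (forall b, endo_left A b -> b ** b ** b = a -> b = a).
Proof.
split=> [iso|[[aa Za] uniq]]; last exact: cube_unique_isolated.
have aa := isolated_idempotent iso; have Za := isolated_centre iso.
by split=> [//|b]; exact: (isolated_cube_unique aa Za).
Qed.

End EndoLeft.

Theorem theorem5p3 (R : realType) :
  (forall (A : banachAlgType R) (a : A),
     isolated (endo_left A) a <->
     (idempotents A `&` centre A) a /\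
     (forall b : A, endo_left A b -> b ** b ** b = a -> b = a))
  /\
  (forall (A : banachAlgType R[i]) (a : A),
     isolated (endo_left A) a <->
     (idempotents A `&` centre A) a /\
     (forall b : A, endo_left A b -> b ** b ** b = a -> b = a)).
Proof. by split=> A a; exact: isolated_endo_leftP. Qed.
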